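(* For each integer $k\geq 1$ let $\sigma_k$ be the probability measure on $\mathbb{R}^k\subset\mathbb{C}^k$ given by $$d\sigma_k(a)=\pi^{-k/2}\,e^{-|a|^2}\,d\lambda_k(a),\qquad a=(a_1,\ldots,a_k)\in\mathbb{R}^k .$$ Then for every integer $k\geq1$, every real $\nu\geq1$, and every $u\in\mathbb{C}^k$ with $|u|=1$, $$\int_{\mathbb{R}^k}\big|\log|\langle a,u\rangle|\big|^\nu\,d\sigma_k(a)\;\leq\;\Gamma_\nu:=2^{2\nu}\int_0^{+\infty}\big|\log x\big|^\nu e^{-x^2}\,dx+2^\nu .$$
   Context: For $a,v\in\mathbb{C}^k$ with $a=(a_1,\ldots,a_k)$, $v=(v_1,\ldots,v_k)$, the (bilinear) pairing is $\langle a,v\rangle=\sum_{j=1}^k a_jv_j$ (no complex conjugation), and $|v|^2=\langle v,\overline v\rangle=\sum_{j=1}^k|v_j|^2$. $\lambda_k$ is the Lebesgue measure on $\mathbb{R}^k\subset\mathbb{C}^k$. The logarithm is the natural logarithm. *)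

(* Defs.v *)
From HB Require Import structures.
From mathcomp Require Import all_boot all_order all_algebra.
From mathcomp Require Import all_classical all_reals all_analysis.
From mathcomp Require Import measurable_realfun complex ring.

Set Implicit Arguments.
Unset Strict Implicit.
Unset Printing Implicit Defensive.

Import Order.TTheory GRing.Theory Num.Theory.
Import numFieldNormedType.Exports.

Local Open Scope classical_set_scope.
Local Open Scope ring_scope.

Definition tuple_cons (T : Type) (k : nat) (p : T * k.-tuple T) :
  k.+1.-tuple T := [tuple of p.1 :: p.2].

(* Lebesgue measure on the Borel sets of R^k, as an iterated product measure;
   its value on boxes is given by [lebesgue_tuple_box] *)
Fixpoint lebesgue_tuple (R : realType) (k : nat) : set (k.-tuple R) -> \bar R :=
  match k with
  | 0 => \d_([tuple] : 0.-tuple R)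
  | k'.+1 =>
      pushforward (@lebesgue_measure R \x @lebesgue_tuple R k')%E
        (@tuple_cons R k')
  end.

Section lebesgue_tuple.
Variable R : realType.

Lemma measurable_tuple_cons k : measurable_fun setT (@tuple_cons R k).
Proof. exact: (measurable_cons measurable_fst measurable_snd). Qed.

Let is_sfinite (k : nat) (mu : set (k.-tuple R) -> \bar R) :=
  exists m : {sigma_finite_measure set (k.-tuple R) -> \bar R}, mu = m.

Let is_sfiniteS k (m : {sigma_finite_measure set (k.-tuple R) -> \bar R}) :
  @is_sfinite k.+1 (pushforward (@lebesgue_measure R \x m)%E (@tuple_cons R k)).
Proof.
pose leb : {sigma_finite_measure set (measurableTypeR R) -> \bar R} :=
  @lebesgue_measure R.
have mc := @measurable_tuple_cons k.
pose mu1 : {measure set (k.+1.-tuple R) -> \bar R} :=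
  @pushforward _ _ _ _ _ (leb \x m)%E (@tuple_cons R k).
pose mu0 := mu1 mc.
have mb : measurable_fun setT (fun t : k.+1.-tuple R => [tuple of behead t]).
  exact: measurable_behead.
have mh := measurable_tnth (@ord0 k) : measurable_fun [set: k.+1.-tuple R] _.
have smu : sigma_finite setT mu0.
  have /sigma_finiteP[F [TF ndF Foo]] := sigma_finiteT leb.
  have /sigma_finiteP[G [TG ndG Goo]] := sigma_finiteT m.
  exists (fun n => ((fun t : k.+1.-tuple R => tnth t ord0) @^-1` F n) `&`
     ((fun t : k.+1.-tuple R => [tuple of behead t]) @^-1` G n)).
    apply/seteqP; split=> [t _|//].
    have [i _ Fi] : (\bigcup_n F n) (tnth t ord0) by rewrite -TF.
    have [j _ Gj] : (\bigcup_n G n) [tuple of behead t] by rewrite -TG.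
    exists (maxn i j) => //; split.
    - by apply: (elimT (subsetPset _ _) (ndF _ _ (leq_maxl i j))) => //.
    - by apply: (elimT (subsetPset _ _) (ndG _ _ (leq_maxr i j))) => //.
  move=> n; have [mF Fy] := Foo n; have [mG Gy] := Goo n; split.
    apply: measurableI; rewrite -[X in measurable X]setTI.
    - exact: mh.
    - exact: mb.
  rewrite /mu0/= /pushforward.
  rewrite (_ : _ @^-1` _ = F n `*` G n); last first.
    apply/seteqP; split=> [[x t]/= [+ ]|[x t]/= []].
    - rewrite /preimage/= => + h; split => //=.
      by move: h; congr (G n _); exact/val_inj.
    - rewrite /preimage/= => Fx h; split => //.
      by move: h; congr (G n _); exact/val_inj.
  by rewrite product_measure1E// lte_mul_pinfty// ge0_fin_numE.
pose H := Measure_isSigmaFinite.Build _ _ _ mu0 smu.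
pose mu : SigmaFiniteMeasure.type _ R := HB.pack (mu0 : set _ -> \bar R) mu0 H.
by exists mu.
Qed.

Let lebesgue_tuple_is_sfinite k : is_sfinite (@lebesgue_tuple R k).
Proof.
elim: k => [|k [m mE]]; first by exists \d_([tuple] : 0.-tuple R).
by rewrite /= mE; exact: is_sfiniteS.
Qed.

Let lebesgue_tuple0 k : lebesgue_tuple (set0 : set (k.-tuple R)) = 0%E.
Proof. by have [m ->] := lebesgue_tuple_is_sfinite k; exact: measure0. Qed.

Let lebesgue_tuple_ge0 k (A : set (k.-tuple R)) : (0 <= lebesgue_tuple A)%E.
Proof. by have [m ->] := lebesgue_tuple_is_sfinite k; exact: measure_ge0. Qed.

Let lebesgue_tuple_sigma_additive k :
  semi_sigma_additive (@lebesgue_tuple R k).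
Proof.
have [m ->] := lebesgue_tuple_is_sfinite k.
exact: measure_semi_sigma_additive.
Qed.

HB.instance Definition _ k := isMeasure.Build _ _ _ (@lebesgue_tuple R k)
  (@lebesgue_tuple0 k) (@lebesgue_tuple_ge0 k) (@lebesgue_tuple_sigma_additive k).

Let lebesgue_tuple_sigma_finite k : sigma_finite setT (@lebesgue_tuple R k).
Proof. by have [m ->] := lebesgue_tuple_is_sfinite k; exact: sigma_finiteT. Qed.

HB.instance Definition _ k := Measure_isSigmaFinite.Build _ _ _
  (@lebesgue_tuple R k) (@lebesgue_tuple_sigma_finite k).

Lemma lebesgue_tuple_box k (A : 'I_k -> set R) :
  (forall i, measurable (A i)) ->
  lebesgue_tuple [set a : k.-tuple R | forall i, A i (tnth a i)] =
  (\prod_(i < k) lebesgue_measure (A i))%E.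
Proof.
elim: k A => [|k IH] A mA.
  rewrite big_ord0 /= diracE mem_set//= => -[//].
rewrite big_ord_recl -IH//.
rewrite /= /pushforward.
rewrite (_ : _ @^-1` _ =
  A ord0 `*` [set a : k.-tuple R | forall i, A (lift ord0 i) (tnth a i)]).
  rewrite product_measure1E//=; first exact: mA.
  rewrite (_ : mkset _ = \bigcap_(i in [set: 'I_k])
     ((fun a : k.-tuple R => tnth a i) @^-1` A (lift ord0 i))); last first.
    by apply/seteqP; split=> [a h i _|a h i]; exact: h.
  apply: fin_bigcap_measurable => // i _.
  by rewrite -[X in measurable X]setTI; exact: measurable_tnth.
apply/seteqP; split=> [[x a]/= h|[x a]/= [Ax h] i].
  split; first exact: (h ord0).
  by move=> i; have := h (lift ord0 i); rewrite /tuple_cons/= tnthS.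
by have [j ->|->] := unliftP ord0 i; rewrite /tuple_cons/= ?tnthS//; exact: h.
Qed.

End lebesgue_tuple.

Section Ck.
Variables (R : realType) (k : nat).
Local Open Scope complex_scope.
Implicit Types (a v : k.-tuple R[i]).

Definition pairing a v : R[i] := \sum_(j < k) tnth a j * tnth v j.

Definition hnorm v : R :=
  Num.sqrt (\sum_(j < k) ComplexField.Normc.normc (tnth v j) ^+ 2).

Definition real_tuple (a : k.-tuple R) : k.-tuple R[i] :=
  map_tuple (real_complex R) a.

Lemma hnorm_pairing v :
  (hnorm v ^+ 2)%:C = pairing v (map_tuple (@conjc R) v).
Proof.
rewrite sqr_sqrtr ?sumr_ge0//; last by move=> j _; exact: sqr_ge0.
rewrite rmorph_sum; apply: eq_bigr => j _; rewrite tnth_map.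
case: (tnth v j) => x y; rewrite /= sqr_sqrtr ?addr_ge0 ?sqr_ge0//.
by apply/eqP; rewrite eq_complex/=; apply/andP; split; apply/eqP; ring.
Qed.

Lemma hnorm_real (a : k.-tuple R) :
  hnorm (real_tuple a) ^+ 2 = \sum_(j < k) tnth a j ^+ 2.
Proof.
rewrite sqr_sqrtr ?sumr_ge0//; last by move=> j _; exact: sqr_ge0.
apply: eq_bigr => j _; rewrite tnth_map/= expr0n/= addr0.
by rewrite sqr_sqrtr ?sqr_ge0.
Qed.

End Ck.

Section gauss_tuple.
Variables (R : realType).

Definition gauss_tuple_pdf (k : nat) (a : k.-tuple R) : R :=
  pi `^ (- (k%:R / 2)) * expR (- hnorm (real_tuple a) ^+ 2).

Definition gauss_tuple (k : nat) (A : set (k.-tuple R)) : \bar R :=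
  (\int[@lebesgue_tuple R k]_(a in A) (gauss_tuple_pdf a)%:E)%E.

Lemma gauss_tuple_pdf_ge0 k (a : k.-tuple R) : 0 <= gauss_tuple_pdf a.
Proof. by rewrite mulr_ge0 ?powR_ge0 ?expR_ge0. Qed.

Lemma measurable_gauss_tuple_pdf k : measurable_fun setT (@gauss_tuple_pdf k).
Proof.
rewrite /gauss_tuple_pdf; under eq_fun do rewrite hnorm_real.
apply: measurable_funM => //; apply: measurableT_comp => //.
apply: measurableT_comp => //; apply: measurable_sum => j.
by apply: measurable_funX; exact: measurable_tnth.
Qed.

Let measurable_EFin_gauss_tuple_pdf k :
  measurable_fun setT (fun a : k.-tuple R => (gauss_tuple_pdf a)%:E).
Proof. by apply/measurable_EFinP; exact: measurable_gauss_tuple_pdf. Qed.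

Lemma gauss_tuple_pdfS k x (a : k.-tuple R) :
  gauss_tuple_pdf (tuple_cons (x, a)) =
  pi `^ (- (1 / 2)) * gauss_fun x * gauss_tuple_pdf a.
Proof.
rewrite /gauss_tuple_pdf !hnorm_real big_ord_recl opprD expRD.
rewrite (_ : - (k.+1%:R / 2) = - (1 / 2) + - (k%:R / 2)); last first.
  by rewrite -opprD -mulrDl -natr1 addrC.
rewrite powRD; last by rewrite (gt_eqF (pi_gt0 R)) implybT.
rewrite (eq_bigr (fun j => tnth a j ^+ 2)); last first.
  by move=> j _; rewrite /tuple_cons tnthS.
by rewrite /gauss_fun /tuple_cons tnth0 /=; ring.
Qed.

Let gauss_tuple_setT k : gauss_tuple [set: k.-tuple R] = 1%E.
Proof.
have mg : measurable_fun [set: measurableTypeR R]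
    (fun x : measurableTypeR R => (gauss_fun x)%:E).
  by apply/measurable_EFinP; exact: measurable_gauss_fun.
rewrite /gauss_tuple; elim: k => [|k IH].
  rewrite integral_dirac//=; last first.
    exact: measurable_EFin_gauss_tuple_pdf.
  rewrite diracT mul1e /gauss_tuple_pdf hnorm_real big_ord0.
  by rewrite mul0r !oppr0 expR0 powRr0 mulr1.
rewrite /= ge0_integral_pushforward//=; last 3 first.
- exact: measurable_tuple_cons.
- exact: measurable_EFin_gauss_tuple_pdf.
- by move=> a _; rewrite lee_fin gauss_tuple_pdf_ge0.
rewrite preimage_setT fubini_tonelli1//=; last 2 first.
- apply/measurable_EFinP; apply: measurableT_comp.
    exact: measurable_gauss_tuple_pdf.
  exact: measurable_tuple_cons.
- by move=> a; rewrite lee_fin gauss_tuple_pdf_ge0.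
rewrite /fubini_F/=.
under eq_integral => x _.
  under eq_integral do rewrite gauss_tuple_pdfS EFinM.
  rewrite ge0_integralZl//=; last 3 first.
  - exact: measurable_EFin_gauss_tuple_pdf.
  - by move=> a _; rewrite lee_fin gauss_tuple_pdf_ge0.
  - by rewrite lee_fin mulr_ge0 ?powR_ge0 ?gauss_fun_ge0.
  rewrite IH mule1 EFinM.
  over.
rewrite ge0_integralZl//=; last 2 first.
- by move=> x _; rewrite lee_fin gauss_fun_ge0.
- by rewrite lee_fin powR_ge0.
rewrite integralT_gauss -EFinM powRN mul1r powR12_sqrt ?pi_ge0//.
by rewrite mulVf// gt_eqF// sqrtr_gt0 pi_gt0.
Qed.

Let gauss_tuple0 k : gauss_tuple (set0 : set (k.-tuple R)) = 0%E.
Proof. by rewrite /gauss_tuple integral_set0. Qed.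

Let gauss_tuple_ge0 k (A : set (k.-tuple R)) : (0 <= gauss_tuple A)%E.
Proof.
by apply: integral_ge0 => a _; rewrite lee_fin gauss_tuple_pdf_ge0.
Qed.

Let gauss_tuple_sigma_additive k : semi_sigma_additive (@gauss_tuple k).
Proof.
move=> A mA tA mUA; rewrite /gauss_tuple ge0_integral_bigcup//; last first.
- by move=> a _; rewrite lee_fin gauss_tuple_pdf_ge0.
- apply: measurable_funTS.
  exact: measurable_EFin_gauss_tuple_pdf.
apply: is_cvg_ereal_nneg_natsum_cond => n _ _.
exact: gauss_tuple_ge0.
Qed.

HB.instance Definition _ k := isMeasure.Build _ _ _ (@gauss_tuple k)
  (@gauss_tuple0 k) (@gauss_tuple_ge0 k) (@gauss_tuple_sigma_additive k).

HB.instance Definition _ k :=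
  Measure_isProbability.Build _ _ _ (@gauss_tuple k) (@gauss_tuple_setT k).

End gauss_tuple.

(* [lne] is the extended logarithm: with [lne 0 = -oo] and [+oo `^ nu = +oo],
   the value at [x = 0] is [+oo] *)
Definition abs_log_pow (R : realType) (nu x : R) : \bar R :=
  (`|lne x%:E| `^ nu)%E.

Definition Gamma_nu (R : realType) (nu : R) : \bar R :=
  ((2 `^ (2 * nu))%:E *
   \int[lebesgue_measure]_(x in `[0%R, +oo[)
     (abs_log_pow nu x * (expR (- x ^+ 2))%:E) + (2 `^ nu)%:E)%E.

(* Main.v *)
Require Import Defs.
From HB Require Import structures.
From mathcomp Require Import all_boot all_order all_algebra.
From mathcomp Require Import all_classical all_reals all_analysis.
From mathcomp Require Import measurable_realfun complex ring lra.

(* Write u = s + i t with s, t real.  Each of X = <a, s> and Y = <a, t> is a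
   centred one-dimensional Gaussian, so X = |s| x and Y = |t| y with x, y of
   density pi^(-1/2) e^(-x^2); no independence is needed.  As
   |s|^2 + |t|^2 = 1, one may assume |s| >= 1/2.  Let Z = |<a, u>|, so that
   Z^2 = X^2 + Y^2.  If Z < 1, then |s| |x| <= Z gives
   |log Z| <= |log |x|| + 1; if Z >= 1, then Z <= max(|x|, |y|).  By convexity
   of the power function,
     |log Z|^nu <= 2^(nu-1) (|log |x||^nu + 1) + |log |y||^nu,
   and it remains to integrate this bound. *)

Set Implicit Arguments.
Unset Strict Implicit.
Unset Printing Implicit Defensive.

Import Order.TTheory GRing.Theory Num.Theory.
Import numFieldNormedType.Exports.

Local Open Scope classical_set_scope.
Local Open Scope ring_scope.

(** * Integration against a measure given by a density *)

Section density.
Local Open Scope ereal_scope.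
Context d (T : measurableType d) (R : realType).
Variables (mu nu : {measure set T -> \bar R}) (g : T -> R).
Hypothesis g0 : forall x, (0 <= g x)%R.
Hypothesis mg : measurable_fun setT g.
Hypothesis nuE : forall A, measurable A -> nu A = \int[mu]_(x in A) (g x)%:E.

Import HBNNSimple.

(** Both sides commute with increasing limits of simple functions, and on the indicator of a
    measurable set the identity is the hypothesis [nuE]. *)
Lemma ge0_integral_density (f : T -> \bar R) : measurable_fun setT f ->
  (forall x, 0 <= f x) -> \int[nu]_x f x = \int[mu]_x (f x * (g x)%:E).
Proof.
move=> mf f0; pose h := nnsfun_approx measurableT mf.
have mh n : measurable_fun setT (EFin \o h n).
  exact/measurable_EFinP/measurable_funP.
have mgE : measurable_fun setT (EFin \o g) by exact/measurable_EFinP.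
have -> : \int[nu]_x f x = limn (fun n => \int[nu]_x (h n x)%:E).
  rewrite -monotone_convergence//=.
  - apply: eq_integral => x _; apply/esym/cvg_lim; first by [].
    exact: cvg_nnsfun_approx.
  - by move=> n x _; rewrite lee_fin.
  - by move=> x _ a b ab; rewrite lee_fin; exact/lefP/nd_nnsfun_approx.
have -> : \int[mu]_x (f x * (g x)%:E) =
    limn (fun n => \int[mu]_x ((h n x)%:E * (g x)%:E)).
  rewrite -monotone_convergence//=.
  - apply: eq_integral => x _; apply/esym/cvg_lim => //.
    by apply: cvgeZr => //; exact: cvg_nnsfun_approx.
  - by move=> n; exact: (emeasurable_funM (mh n) mgE).
  - by move=> n x _; rewrite mule_ge0// lee_fin.
  - move=> x _ a b ab; rewrite lee_wpmul2r ?lee_fin//.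
    exact/lefP/nd_nnsfun_approx.
(* For one simple function [h n], both integrals are finite sums over its values, compared term by
   term. *)
congr (limn _); apply/funext => n.
under eq_integral do rewrite fimfunE -fsumEFin//.
rewrite ge0_integral_fsum//=; last 2 first.
- by move=> r; apply/measurable_EFinP; exact: measurable_funM.
- by move=> r x _; exact: nnfun_muleindic_ge0.
under [RHS]eq_integral.
  move=> x _; rewrite fimfunE -fsumEFin// ge0_mule_fsuml; last first.
    by move=> r; exact: nnfun_muleindic_ge0.
  over.
rewrite ge0_integral_fsum//=; last 2 first.
- move=> r; apply: emeasurable_funM => //.
  by apply/measurable_EFinP; exact: measurable_funM.
- by move=> r x _; rewrite mule_ge0 ?lee_fin// -lee_fin nnfun_muleindic_ge0.
apply: eq_fsbigr => r /set_mem[y _ <-].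
rewrite integralZl_indic_nnsfun//= integral_indic//= setIT nuE//.
have mpre : measurable (h n @^-1` [set h n y]).
  exact: measurable_funPTI.
(* The integral over the level set becomes one over the whole space, so that it can be matched
   pointwise with the indicator. *)
rewrite integral_mkcond -ge0_integralZl//=.
- apply: eq_integral => x _; rewrite patchE EFinM -muleA.
  rewrite indicE; case: ifP => _; first by rewrite mul1e.
  by rewrite mul0e.
- by apply/(measurable_restrictT _ _).1 => //; exact: measurable_funTS.
- by move=> x _; rewrite patchE; case: ifP => _; rewrite lee_fin.
- by rewrite lee_fin.
Qed.

End density.

(** * Affine changes of variable for Lebesgue measure on the line *)

Section affine.
Context (R : realType).
Let mu := @lebesgue_measure R.

Lemma measurable_affine (c d : R) :
  measurable_fun [set: R] (fun x => c * x + d).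
Proof. by apply: measurable_funD => //; exact: measurable_funM. Qed.

(** Lebesgue measure is determined by its values on half-open intervals, and the preimage of []a,
    b]] under the affine map is an interval of length (b - a) / c. *)
Lemma lebesgue_measure_affine (c d : R) (A : set R) : 0 < c -> measurable A ->
  (c%:E * pushforward mu (fun x : R => c * x + d)%R A)%E = mu A.
Proof.
move=> c0 mA.
have mphi : measurable_fun [set: measurableTypeR R]
    ((fun x => c * x + d) : _ -> measurableTypeR R).
  exact: measurable_affine.
pose m1 : {measure set (measurableTypeR R) -> \bar R} := pushforward mu
  ((fun x : R => c * x + d) : measurableTypeR R -> measurableTypeR R).
pose m2 : {measure set (measurableTypeR R) -> \bar R} :=
  mscale (NngNum (ltW c0)) (m1 mphi).
rewrite [RHS](lebesgue_measure_unique (mu := m2)) // => _ [[a b]] _ <-.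
rewrite /m2/= /mscale/= /pushforward.
have -> : (fun x : R => c * x + d) @^-1` `]a, b] =
    `](a - d) / c, (b - d) / c]%classic.
  apply/seteqP; split => x /=; rewrite !in_itv/= ltr_pdivrMr// ler_pdivlMr//;
    by rewrite mulrC ltrBlDr lerBrDr.
rewrite !lebesgue_measure_itv/= !lte_fin ltr_pM2r ?invr_gt0// ltrD2r.
case: ifPn => _; last by rewrite mule0.
rewrite -!EFinB -EFinM; congr EFin.
by field; rewrite gt_eqF.
Qed.

Lemma ge0_integral_affine (c d : R) (f : R -> \bar R) : 0 < c ->
  measurable_fun [set: R] f -> (forall x, 0 <= f x)%E ->
  (\int[mu]_x f x = c%:E * \int[mu]_x f (c * x + d)%R)%E.
Proof.
move=> c0 mf f0.
have mphi : measurable_fun [set: measurableTypeR R]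
    ((fun x => c * x + d) : _ -> measurableTypeR R).
  exact: measurable_affine.
pose m1 : {measure set (measurableTypeR R) -> \bar R} := pushforward mu
  ((fun x : R => c * x + d) : measurableTypeR R -> measurableTypeR R).
pose m2 : {measure set (measurableTypeR R) -> \bar R} :=
  mscale (NngNum (ltW c0)) (m1 mphi).
transitivity (\int[m2]_x f x)%E.
  apply: eq_measure_integral => A mA _; exact/esym/lebesgue_measure_affine.
rewrite ge0_integral_mscale//=; congr (_ * _)%E.
by rewrite ge0_integral_pushforward//= preimage_setT.
Qed.

Lemma ge0_integralN (f : R -> \bar R) :
  measurable_fun [set: R] f -> (forall x, 0 <= f x)%E ->
  (\int[mu]_x f x = \int[mu]_x f (- x)%R)%E.
Proof.
move=> mf f0.
transitivity (\int[pushforward mu (-%R : _ -> measurableTypeR R)]_x f x)%E.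
  by apply: eq_measure_integral => A mA _; exact/esym/lebesgue_measureN.
by rewrite ge0_integral_pushforward//= preimage_setT.
Qed.

Local Open Scope ereal_scope.

Lemma ge0_even_integralT (f : R -> \bar R) : measurable_fun [set: R] f ->
  (forall x, 0 <= f x) -> f =1 f \o -%R ->
  \int[mu]_x f x = 2%:E * \int[mu]_(x in `[0%R, +oo[) f x.
Proof.
move=> mf f0 evenf.
rewrite -(setUv `[0%R, +oo[%classic) ge0_integral_setU//=; last 3 first.
- exact: measurableC.
- by rewrite setUv.
- exact/disj_setPCl.
rewrite mule_natl mule2n; congr +%E.
(* Adding the null point 0 to the negative half-line makes it the exact reflection of [[0, +oo[]. *)
rewrite setCitvr integral_itv_bndo_bndc; last exact: measurable_funTS.
rewrite ge0_integration_by_substitution0//.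
by apply: eq_integral => x _; rewrite (evenf x).
Qed.

End affine.

(** * The one-dimensional Gaussian density and its stability *)

Section gaussian.
Context (R : realType).
Let mu := @lebesgue_measure R.
Local Open Scope ereal_scope.

(** The density of the centred normal law of variance 1/2, which is the one-coordinate factor of
    [gauss_tuple_pdf]. *)
Definition gauss_pdf (x : R) : R := (pi `^ (- (1 / 2)) * gauss_fun x)%R.

Lemma gauss_pdf_ge0 x : (0 <= gauss_pdf x)%R.
Proof. by rewrite mulr_ge0 ?powR_ge0 ?gauss_fun_ge0. Qed.

Lemma measurable_gauss_pdf : measurable_fun [set: R] gauss_pdf.
Proof. by apply: measurable_funM => //; exact: measurable_gauss_fun. Qed.

Lemma gauss_pdfN x : gauss_pdf (- x) = gauss_pdf x.
Proof. by rewrite /gauss_pdf /gauss_fun sqrrN. Qed.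

Lemma integral_gauss_pdf : \int[mu]_x (gauss_pdf x)%:E = 1.
Proof.
under eq_integral do rewrite EFinM.
rewrite ge0_integralZl//=.
- rewrite integralT_gauss -EFinM powRN mul1r powR12_sqrt ?pi_ge0//.
  by rewrite mulVf// gt_eqF// sqrtr_gt0 pi_gt0.
- by apply/measurable_EFinP; exact: measurable_gauss_fun.
- by move=> x _; rewrite lee_fin gauss_fun_ge0.
- by rewrite lee_fin powR_ge0.
Qed.

Lemma integral_gauss_pdf_affine c d : (0 < c)%R ->
  \int[mu]_x (gauss_pdf (c * x + d))%:E = (c^-1)%:E.
Proof.
move=> c0.
have mg : measurable_fun [set: R] (EFin \o gauss_pdf).
  by apply/measurable_EFinP; exact: measurable_gauss_pdf.
have := ge0_integral_affine d c0 mg (fun x => gauss_pdf_ge0 x).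
rewrite integral_gauss_pdf => /(congr1 (fun y => c^-1%:E * y)).
by rewrite mule1 muleA -EFinM mulVf ?gt_eqF// mul1e => ->.
Qed.

(* Completes the square in x after the change of variable z = a x + b y. *)
Lemma gauss_pdf_rotation (a b r x z : R) : (0 < b)%R -> (0 < r)%R ->
  (r ^+ 2 = a ^+ 2 + b ^+ 2)%R ->
  (gauss_pdf (b^-1 * z - b^-1 * a * x) * gauss_pdf x =
   gauss_pdf (r^-1 * z) * gauss_pdf (r / b * x - a * z / (r * b)))%R.
Proof.
move=> b0 r0 rE.
rewrite /gauss_pdf /gauss_fun mulrACA -expRD [RHS]mulrACA -expRD.
have b_neq0 : b != 0%R by rewrite gt_eqF.
have r_neq0 : r != 0%R by rewrite gt_eqF.
congr (_ * expR _)%R.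
have -> : (r / b * x - a * z / (r * b) = (r ^+ 2 * x - a * z) / (r * b))%R.
  by field; rewrite ?b_neq0 ?r_neq0.
have -> : (b^-1 * z - b^-1 * a * x = r * (z - a * x) / (r * b))%R.
  by field; rewrite ?b_neq0 ?r_neq0.
have -> : (r^-1 * z = b * z / (r * b))%R by field; rewrite ?b_neq0 ?r_neq0.
have -> : (x ^+ 2 = (x * (r * b)) ^+ 2 / (r * b) ^+ 2)%R.
  by field; rewrite ?b_neq0 ?r_neq0.
rewrite !expr_div_n -!opprD -!mulrDl; congr (- (_ / _))%R.
rewrite !exprMn.
have -> : (b ^+ 2 = r ^+ 2 - a ^+ 2)%R by rewrite rE; ring.
ring.
Qed.

(** For b > 0, take z = a x + b y as inner variable and exchange the integrals; completing the
    square then leaves a Gaussian integral in x, a constant. This is the stability of the normal law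
    under independent sums. *)
Lemma ge0_integral_gauss_pdf_comb (a b : R) (f : R -> \bar R) : (0 <= b)%R ->
  measurable_fun [set: R] f -> (forall x, 0 <= f x) ->
  \int[mu]_x ((\int[mu]_y (f (a * x + b * y)%R * (gauss_pdf y)%:E)) *
              (gauss_pdf x)%:E) =
  \int[mu]_x (f (Num.sqrt (a ^+ 2 + b ^+ 2) * x)%R * (gauss_pdf x)%:E).
Proof.
move=> b0 mf f0.
have mgE : measurable_fun [set: R] (EFin \o gauss_pdf).
  by apply/measurable_EFinP; exact: measurable_gauss_pdf.
have mfa c d : measurable_fun [set: R] (fun x => f (c * x + d)%R).
  by apply: measurableT_comp => //; exact: measurable_affine.
(* The case b = 0 admits no change of variable: the inner integral is trivial, and the sign of a is
   absorbed by the evenness of [gauss_pdf]. *)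
move: b0; rewrite le_eqVlt => /predU1P[<-|b0].
  rewrite expr0n/= addr0 sqrtr_sqr.
  under eq_integral => x _.
    under eq_integral do rewrite mul0r.
    rewrite ge0_integralZl//=; last 1 first.
      by move=> y _; rewrite lee_fin gauss_pdf_ge0.
    rewrite integral_gauss_pdf mule1 addr0; over.
  have [a0|a0] := leP 0%R a; first by rewrite ger0_norm.
  rewrite ltr0_norm// [RHS]ge0_integralN//.
  - by apply: eq_integral => x _; rewrite mulrNN gauss_pdfN.
  - apply: emeasurable_funM => //.
    by have := mfa (- a)%R 0%R; under eq_fun do rewrite addr0.
  - by move=> x; rewrite mule_ge0// lee_fin gauss_pdf_ge0.
set r := Num.sqrt _.
have r0 : (0 < r)%R by rewrite sqrtr_gt0 ltr_wpDl ?sqr_ge0// exprn_gt0.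
have rE : (r ^+ 2 = a ^+ 2 + b ^+ 2)%R.
  by rewrite sqr_sqrtr// addr_ge0// sqr_ge0.
have bV0 : (0 < b^-1)%R by rewrite invr_gt0.
(* Substitutes y = (z - a x) / b, whose Jacobian is 1 / b. *)
transitivity (\int[mu]_x \int[mu]_z (f z *
   ((b^-1 * (gauss_pdf (b^-1 * z - b^-1 * a * x) * gauss_pdf x))%R)%:E)).
  apply: eq_integral => x _.
  pose H y := f (a * x + b * y)%R * (gauss_pdf y)%:E.
  have mH : measurable_fun [set: R] H.
    apply: emeasurable_funM => //; under eq_fun do rewrite addrC.
    exact: mfa.
  have H0 y : 0 <= H y by rewrite mule_ge0// lee_fin gauss_pdf_ge0.
  have mHa c d : measurable_fun [set: R] (fun y => H (c * y + d)%R).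
    by apply: measurableT_comp => //; exact: measurable_affine.
  rewrite -/(H _) (ge0_integral_affine (- (b^-1 * a * x)) bV0 mH H0).
  rewrite -ge0_integralZl//; [|exact: mHa|by rewrite lee_fin ltW].
  rewrite -ge0_integralZr//; last 3 first.
  - by apply: emeasurable_funM => //; exact: mHa.
  - by move=> y _; rewrite mule_ge0// lee_fin ltW.
  - by rewrite lee_fin gauss_pdf_ge0.
  apply: eq_integral => z _; rewrite /H.
  rewrite (_ : a * x + b * (b^-1 * z - b^-1 * a * x) = z)%R; last first.
    by field; rewrite gt_eqF.
  by rewrite -!muleA muleCA -!EFinM.
have mK : measurable_fun [set: measurableTypeR R * measurableTypeR R]
    (fun p => f p.2 * ((b^-1 * (gauss_pdf (b^-1 * p.2 - b^-1 * a * p.1) *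
      gauss_pdf p.1))%R)%:E).
  apply: emeasurable_funM; first exact: measurableT_comp.
  apply/measurable_EFinP; apply: measurable_funM => //; apply: measurable_funM.
    apply: measurableT_comp; first exact: measurable_gauss_pdf.
    by apply: measurable_funB; apply: measurable_funM.
  by apply: measurableT_comp => //; exact: measurable_gauss_pdf.
have K0 p : 0 <= f p.2 * ((b^-1 *
    (gauss_pdf (b^-1 * p.2 - b^-1 * a * p.1) * gauss_pdf p.1))%R)%:E.
  by rewrite mule_ge0// lee_fin mulr_ge0 ?(ltW bV0)// mulr_ge0 ?gauss_pdf_ge0.
(* Tonelli makes x the inner variable; z is then fixed and its Gaussian factor comes out of the
   integral. *)
have /= -> := @fubini_tonelli _ _ _ _ R lebesgue_measure lebesgue_measure _
  mK K0.
pose G z := f z * (r^-1 * gauss_pdf (r^-1 * z))%:E.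
have mgr : measurable_fun [set: R] (fun z => (r^-1 * gauss_pdf (r^-1 * z))%R).
  apply: measurable_funM => //.
  apply: measurableT_comp; last exact: measurable_funM.
  exact: measurable_gauss_pdf.
(* The inner integral over x equals b / r, which turns the Jacobian 1 / b into 1 / r. *)
transitivity (\int[mu]_z G z).
  apply: eq_integral => z _.
  under eq_integral do
    rewrite (gauss_pdf_rotation _ _ b0 r0 rE) mulrA EFinM muleA.
  have rb0 : (0 < r / b)%R by rewrite divr_gt0.
  rewrite ge0_integralZl//; last 3 first.
  - apply/measurable_EFinP.
    apply: measurableT_comp; first exact: measurable_gauss_pdf.
    exact: measurable_affine.
  - by move=> x _; rewrite lee_fin gauss_pdf_ge0.
  - by rewrite mule_ge0// lee_fin mulr_ge0 ?(ltW bV0)// gauss_pdf_ge0.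
  rewrite integral_gauss_pdf_affine// /G -muleA -EFinM; congr (_ * _%:E).
  by field; rewrite !gt_eqF.
have mG : measurable_fun [set: R] G.
  by apply: emeasurable_funM => //; exact/measurable_EFinP.
have G0 z : 0 <= G z.
  rewrite mule_ge0// lee_fin mulr_ge0 ?gauss_pdf_ge0//.
  by rewrite invr_ge0 ltW.
(* Substituting r z for z cancels the factor 1 / r. *)
rewrite (ge0_integral_affine 0 r0)// -ge0_integralZl//; last 2 first.
- by apply: measurableT_comp => //; exact: measurable_affine.
- by rewrite lee_fin ltW.
apply: eq_integral => z _.
rewrite /G addr0 mulKf ?gt_eqF// muleCA -EFinM mulrA mulfV ?gt_eqF//.
by rewrite mul1r.
Qed.

End gaussian.

(** * One-dimensional marginals of the Gaussian measure on R^k *)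

Section gauss_tuple_marginal.
Context (R : realType).
Let mu := @lebesgue_measure R.
Local Open Scope ereal_scope.

Let dot k (s a : k.-tuple R) : R := (\sum_(j < k) tnth a j * tnth s j)%R.

Let measurable_dot k (s : k.-tuple R) : measurable_fun setT (dot s).
Proof.
apply: measurable_sum => j; apply: measurable_funM => //.
exact: measurable_tnth.
Qed.

Let measurable_gauss_tuple_pdfE k :
  measurable_fun setT (EFin \o @gauss_tuple_pdf R k).
Proof. by apply/measurable_EFinP; exact: measurable_gauss_tuple_pdf. Qed.

(** Induction on the dimension: the first coordinate is split off, the others are replaced by one
    Gaussian variable scaled by the norm of the tail of [s], and [ge0_integral_gauss_pdf_comb]
    merges the two. *)
Lemma ge0_integral_lebesgue_tuple_gauss k (s : k.-tuple R) (f : R -> \bar R) :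
  measurable_fun [set: R] f -> (forall x, 0 <= f x) ->
  \int[@lebesgue_tuple R k]_a
    (f (\sum_(j < k) tnth a j * tnth s j)%R * (gauss_tuple_pdf a)%:E) =
  \int[mu]_x (f (Num.sqrt (\sum_(j < k) tnth s j ^+ 2) * x)%R *
    (gauss_pdf x)%:E).
Proof.
elim: k s f => [|k IH] s f mf f0.
  (* On R^0 the measure is a Dirac mass and the density is 1; both sides reduce to [f 0]. *)
  rewrite integral_dirac//=; last first.
    apply: emeasurable_funM; last exact: measurable_gauss_tuple_pdfE.
    by apply: measurableT_comp => //; exact: measurable_dot.
  rewrite diracT mul1e /gauss_tuple_pdf hnorm_real !big_ord0.
  rewrite mul0r !oppr0 expR0 powRr0 mulr1 mule1 sqrtr0.
  under eq_integral do rewrite mul0r.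
  rewrite ge0_integralZl// ?integral_gauss_pdf ?mule1//.
  - by apply/measurable_EFinP; exact: measurable_gauss_pdf.
  - by move=> x _; rewrite lee_fin gauss_pdf_ge0.
case/tupleP: s => s0 s.
have mF : measurable_fun setT (fun a : k.+1.-tuple R =>
    f (dot [tuple of s0 :: s] a) * (gauss_tuple_pdf a)%:E).
  apply: emeasurable_funM; last exact: measurable_gauss_tuple_pdfE.
  by apply: measurableT_comp => //; exact: measurable_dot.
have F0 (a : k.+1.-tuple R) :
    0 <= f (dot [tuple of s0 :: s] a) * (gauss_tuple_pdf a)%:E.
  by rewrite mule_ge0// lee_fin gauss_tuple_pdf_ge0.
rewrite /= ge0_integral_pushforward//; last 2 first.
- exact: measurable_tuple_cons.
- by move=> a _; exact: F0.
rewrite preimage_setT fubini_tonelli1//; last 2 first.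
- exact: (measurableT_comp mF (@measurable_tuple_cons R k)).
- by move=> a; exact: F0.
rewrite /fubini_F/= big_ord_recl tnth0.
under [in RHS]eq_bigr do rewrite tnthS.
have s_ge0 : (0 <= \sum_(j < k) tnth s j ^+ 2)%R.
  by apply: sumr_ge0 => j _; exact: sqr_ge0.
(* The squared norm of the tail is written as a square to give the right-hand side the form
   sqrt(s0^2 + b^2). *)
rewrite -(sqr_sqrtr s_ge0).
rewrite -(ge0_integral_gauss_pdf_comb s0 (sqrtr_ge0 _) mf f0).
apply: eq_integral => x _.
have mfx : measurable_fun [set: R] (fun y => f (s0 * x + y)%R).
  by apply: measurableT_comp => //; exact: measurable_funD.
(* With x fixed, the induction hypothesis is applied to the translate of [f] by [s0 * x]. *)
rewrite -(IH s _ mfx)//.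
rewrite -ge0_integralZr//; last 3 first.
- apply: emeasurable_funM; last exact: measurable_gauss_tuple_pdfE.
  exact: (measurableT_comp mfx (measurable_dot s)).
- by move=> a _; rewrite mule_ge0// lee_fin gauss_tuple_pdf_ge0.
- by rewrite lee_fin gauss_pdf_ge0.
apply: eq_integral => a _.
rewrite gauss_tuple_pdfS -/(gauss_pdf x) -muleA -EFinM.
rewrite [(gauss_pdf x * _)%R]mulrC.
congr (f _ * _); rewrite big_ord_recl /tuple_cons !tnth0 mulrC; congr (_ + _)%R.
by apply: eq_bigr => j _; rewrite !tnthS.
Qed.

(** Passing to the density by [ge0_integral_density] reduces this to Lebesgue measure; it gives the
    law of a real linear form. *)
Lemma ge0_integral_gauss_tuple_comb k (s : k.-tuple R) (f : R -> \bar R) :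
  measurable_fun [set: R] f -> (forall x, 0 <= f x) ->
  \int[@gauss_tuple R k]_a f (\sum_(j < k) tnth a j * tnth s j)%R =
  \int[mu]_x (f (Num.sqrt (\sum_(j < k) tnth s j ^+ 2) * x)%R *
    (gauss_pdf x)%:E).
Proof.
move=> mf f0; rewrite -ge0_integral_lebesgue_tuple_gauss//.
apply: ge0_integral_density => //.
- exact: gauss_tuple_pdf_ge0.
- exact: measurable_gauss_tuple_pdf.
- exact: (measurableT_comp mf (measurable_dot s)).
Qed.

End gauss_tuple_marginal.

(** * Pointwise bound for powers of the logarithm *)

Section abs_log_pow.
Context (R : realType) (nu : R).
Hypothesis nu1 : 1 <= nu.

Let nu_neq0 : nu != 0.
Proof. by rewrite gt_eqF// (lt_le_trans _ nu1). Qed.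

(** [lne] is -oo at every x <= 0 and nu is nonzero, so the power is +oo there; elsewhere real
    arithmetic applies. *)
Lemma abs_log_powE x :
  abs_log_pow nu x = if x <= 0 then +oo%E else (`|ln x| `^ nu)%:E.
Proof.
rewrite /abs_log_pow; case: ifPn => [x0|]; last first.
  by rewrite -ltNge => x0; rewrite lne_EFin// abseEFin poweR_EFin.
by rewrite le0_lneNy ?lee_fin// poweRyr.
Qed.

Lemma abs_log_pow_ge0 x : (0 <= abs_log_pow nu x)%E.
Proof. exact: poweR_ge0. Qed.

Lemma measurable_abs_log_pow : measurable_fun [set: R] (abs_log_pow nu).
Proof.
rewrite (funext abs_log_powE); apply: measurable_fun_ifT => //.
  exact: measurable_fun_ler.
apply: measurableT_comp => //.
apply: (@measurableT_comp _ _ _ _ _ _ (@powR R ^~ nu)) => //.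
by apply: measurableT_comp => //; exact: measurable_ln.
Qed.

(** Convexity of the power function at the midpoint of 2 x and 2 y; the constant is 2^nu / 2. *)
Lemma powRD_le (x y : R) : 0 <= x -> 0 <= y ->
  (x + y) `^ nu <= 2 `^ (nu - 1) * (x `^ nu + y `^ nu).
Proof.
move=> x0 y0.
have h0 : 0 <= 2^-1 :> R by rewrite invr_ge0.
have h1 : 2^-1 <= 1 :> R by rewrite invf_le1// ler1n.
have := @convex_powR _ _ nu1 (Itv01 h0 h1) (2 * x) (2 * y).
rewrite !inE/= !in_itv/= !andbT !mulr_ge0// => /(_ isT isT).
have half : 1 - 2^-1 = 2^-1 :> R by field.
rewrite convRE [X in X `^ _ <= _ -> _]convRE/= /unstable.onem half.
rewrite !mulKf ?pnatr_eq0// => /le_trans; apply.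
rewrite !powRM// -mulrDr -mulrDr mulrA powRD ?pnatr_eq0 ?implybT//.
by rewrite powR_inv1// [2^-1 * _]mulrC.
Qed.

(** The bound to be integrated: z stands for the modulus of the pairing, x and y for the pairings
    with the unit directions of Re u and Im u, possibly exchanged. *)
Lemma abs_log_pow_le (a b x y z : R) : 2^-1 <= a -> 0 <= b -> 0 <= z ->
  a ^+ 2 + b ^+ 2 = 1 -> z ^+ 2 = (a * x) ^+ 2 + (b * y) ^+ 2 ->
  (abs_log_pow nu z <=
   (2 `^ (nu - 1))%:E * (abs_log_pow nu `|x|%R + 1) + abs_log_pow nu `|y|%R)%E.
Proof.
move=> a2 b0 z0 ab1 zE.
have a0 : 0 < a by rewrite (lt_le_trans _ a2)// invr_gt0.
have p0 : 0 < 2 `^ (nu - 1) by rewrite powR_gt0.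
have p1 : 1 <= 2 `^ (nu - 1).
  by rewrite -[leLHS](powRr0 2); apply: ler_powR; rewrite ?ler1n ?subr_ge0.
have nu0 : 0 <= nu by rewrite (le_trans _ nu1).
rewrite !abs_log_powE !normr_le0.
(* The right-hand side is +oo when x = 0 or y = 0; otherwise z > 0 and every logarithm is finite. *)
have [_|x0] := eqVneq x 0.
  by rewrite addye// gt0_muley ?lte_fin// addye ?leey//; case: ifP.
have [_|y0] := eqVneq y 0; first by rewrite addey ?leey.
have z_gt0 : 0 < z.
  rewrite lt_neqAle z0 andbT eq_sym -sqrf_eq0 zE paddr_eq0 ?sqr_ge0//.
  by rewrite sqrf_eq0 mulf_eq0 (negbTE x0) gt_eqF.
rewrite [z <= 0]leNgt z_gt0/= -EFinD lee_fin.
have xnu : 0 <= `|ln `|x| | `^ nu by exact: powR_ge0.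
have ynu : 0 <= `|ln `|y| | `^ nu by exact: powR_ge0.
have ln_le w v : 1 <= w -> w <= v -> `|ln w| `^ nu <= `|ln v| `^ nu.
  move=> w1 wv; have v1 := le_trans w1 wv.
  rewrite !ger0_norm ?ln_ge0// ge0_ler_powR// ?nnegrE ?ln_ge0//.
  by rewrite ler_ln// posrE (lt_le_trans _ w1, lt_le_trans _ v1).
have [z1|z1] := leP 1 z.
  (* z^2 is a convex combination of x^2 and y^2, with weights a^2 and b^2. *)
  have z_max : z <= Num.max `|x| `|y|.
    rewrite -ler_sqr ?nnegrE ?le_max ?normr_ge0//.
    rewrite zE !exprMn -[leRHS]mul1r -ab1 mulrDl.
    by rewrite lerD// ler_wpM2l ?sqr_ge0// -[leLHS]real_normK ?num_real//
      ler_sqr ?nnegrE ?le_max ?normr_ge0 ?lexx ?orbT.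
  move: z_max; rewrite le_max => /orP[zx|zy].
    apply: (le_trans (ln_le _ _ z1 zx)); rewrite ler_wpDr// mulrDr mulr1.
    by rewrite ler_wpDr ?powR_ge0// ler_peMl.
  apply: (le_trans (ln_le _ _ z1 zy)).
  by rewrite ler_wpDl// mulr_ge0 ?powR_ge0// addr_ge0.
(* For z < 1 the term in y is dropped and only a |x| <= z is used. *)
rewrite ler_wpDr//.
have ax : a * `|x| <= z.
  rewrite -ler_sqr ?nnegrE ?mulr_ge0 ?(ltW a0)// zE !exprMn.
  rewrite real_normK ?num_real//.
  by rewrite lerDl -exprMn sqr_ge0.
have x_gt0 : 0 < `|x| by rewrite normr_gt0.
(* Here a >= 1/2 enters: -ln a = ln (1/a) <= 1/a - 1 <= 1. *)
have lna : - ln a <= 1.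
  rewrite -lnV ?posrE//.
  have aV : a^-1 <= 2 by rewrite -[leRHS]invrK lef_pV2 ?posrE ?invr_gt0.
  have := @le_ln1Dx _ (a^-1 - 1); rewrite subrKC => /(_ _)/le_trans; apply.
    by rewrite ltrBrDl subrr invr_gt0.
  by rewrite lerBlDr.
have lnz : `|ln z| <= `|ln `|x| | + 1.
  rewrite ler0_norm ?ln_le0 ?(ltW z1)//.
  apply: (@le_trans _ _ (- ln (a * `|x|))).
    by rewrite lerN2 ler_ln ?posrE ?mulr_gt0.
  rewrite lnM ?posrE// opprD addrC lerD//.
  by rewrite -[leRHS]normrN ler_norm.
apply: (@le_trans _ _ ((`|ln `|x| | + 1) `^ nu)).
  by rewrite ge0_ler_powR// nnegrE addr_ge0.
by have := powRD_le (normr_ge0 (ln `|x|)) ler01; rewrite powR1.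
Qed.

End abs_log_pow.

(** * Comparison of the integrated bound with [Gamma_nu] *)

Section log_moment.
Context (R : realType) (nu : R).
Hypothesis nu1 : 1 <= nu.
Let mu := @lebesgue_measure R.
Local Open Scope ereal_scope.

(** The value, for every real unit vector w, of the integral of |log |<v, w>||^nu against
    [gauss_tuple]. *)
Let J := \int[mu]_x (abs_log_pow nu `|x| * (gauss_pdf x)%:E).

Let I := \int[mu]_(x in `[0%R, +oo[)
  (abs_log_pow nu x * (expR (- x ^+ 2))%:E).

Let mlog_norm : measurable_fun [set: R] (fun x => abs_log_pow nu `|x|).
Proof. by apply: measurableT_comp => //; exact: measurable_abs_log_pow. Qed.

(** The integrand is even, hence the factor 2; the normalisation pi^(-1/2) comes out of the
    integral. *)
Let JE : J = (2 * pi `^ (- (1 / 2)))%:E * I.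
Proof.
rewrite /J ge0_even_integralT//; last 3 first.
- apply: emeasurable_funM => //.
  by apply/measurable_EFinP; exact: measurable_gauss_pdf.
- by move=> x; rewrite mule_ge0 ?abs_log_pow_ge0// lee_fin gauss_pdf_ge0.
- by move=> x /=; rewrite normrN gauss_pdfN.
rewrite EFinM -muleA; congr (_ * _).
rewrite -ge0_integralZl//=; last 3 first.
- apply: emeasurable_funM.
    by apply: measurable_funTS; exact: measurable_abs_log_pow.
  by apply/measurable_EFinP/measurable_funTS; exact: measurable_gauss_fun.
- by move=> x _; rewrite mule_ge0 ?abs_log_pow_ge0// lee_fin expR_ge0.
- by rewrite lee_fin powR_ge0.
apply: eq_integral => x; rewrite inE/= in_itv/= andbT => x0.
by rewrite ger0_norm// /gauss_pdf EFinM muleCA.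
Qed.

Let I_ge0 : 0 <= I.
Proof.
apply: integral_ge0 => x _.
by rewrite mule_ge0 ?abs_log_pow_ge0// lee_fin expR_ge0.
Qed.

(** Since p = pi^(-1/2) <= 1 <= q = 2^(nu-1), the coefficient 2 p (q + 1) of [I] on the left is at
    most (2 q)^2, and q <= 2 q settles the constants. *)
Let log_moment_le_Gamma_nu :
  (2 `^ (nu - 1))%:E * (J + 1) + J <= Gamma_nu nu.
Proof.
rewrite /Gamma_nu -/I JE.
set q := (2 `^ (nu - 1))%R; set p := (pi `^ (- (1 / 2)))%R.
have q1 : (1 <= q)%R.
  by rewrite -[leLHS](powRr0 2); apply: ler_powR; rewrite ?ler1n ?subr_ge0.
have p0 : (0 <= p)%R by exact: powR_ge0.
have p1 : (p <= 1)%R.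
  have pi1 : (1 <= pi :> R)%R by rewrite (le_trans _ (pi_ge2 R))// ler1n.
  rewrite -[leRHS](powRr0 pi).
  by apply: ler_powR => //; rewrite oppr_le0 divr_ge0.
have q2 : (2 `^ nu = 2 * q)%R.
  rewrite /q powRB ?pnatr_eq0 ?implybT// powRr1// mulrCA.
  by rewrite mulfV ?mulr1// pnatr_eq0.
have -> : (2 `^ (2 * nu) = (2 * q) ^+ 2)%R.
  by rewrite -q2 -powR_mulrn ?powR_ge0// -powRrM mulrC.
rewrite q2; move: I_ge0; case: I => [r| |//].
  rewrite lee_fin => r0; rewrite -!EFinM -!EFinD lee_fin.
  have : (2 * p * (q + 1) <= (2 * q) ^+ 2)%R by nra.
  by move=> /(ler_wpM2r r0); lra.
(* If [I] is +oo, so is the right-hand side. *)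
move=> _; rewrite [X in _ <= X + _]gt0_muley ?addye ?leey// lte_fin exprn_gt0//.
by rewrite mulr_gt0// (lt_le_trans _ q1).
Qed.

(** Integrates [abs_log_pow_le]. The two linear forms enter through separate terms, so only their
    individual laws matter, and both give [J]. *)
Lemma gauss_tuple_log_moment_le k (s t : k.-tuple R) (a b : R) :
  (\sum_(j < k) tnth s j ^+ 2 = 1)%R -> (\sum_(j < k) tnth t j ^+ 2 = 1)%R ->
  (2^-1 <= a)%R -> (0 <= b)%R -> (a ^+ 2 + b ^+ 2 = 1)%R ->
  \int[@gauss_tuple R k]_v abs_log_pow nu
    (Num.sqrt ((a * \sum_(j < k) tnth v j * tnth s j) ^+ 2 +
               (b * \sum_(j < k) tnth v j * tnth t j) ^+ 2))
  <= Gamma_nu nu.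
Proof.
move=> s1 t1 a2 b0 ab1; apply: le_trans log_moment_le_Gamma_nu.
have mdot (w : k.-tuple R) : measurable_fun [set: k.-tuple R]
    (fun v => \sum_(j < k) tnth v j * tnth w j)%R.
  apply: measurable_sum => j; apply: measurable_funM => //.
  exact: measurable_tnth.
have mlog (w : k.-tuple R) : measurable_fun [set: k.-tuple R]
    (fun v => abs_log_pow nu `|\sum_(j < k) tnth v j * tnth w j|%R).
  exact: (measurableT_comp mlog_norm (mdot w)).
have intJ (w : k.-tuple R) : (\sum_(j < k) tnth w j ^+ 2 = 1)%R ->
    \int[@gauss_tuple R k]_v
      abs_log_pow nu `|\sum_(j < k) tnth v j * tnth w j|%R = J.
  move=> w1; rewrite (ge0_integral_gauss_tuple_comb w mlog_norm); last first.
    by move=> x; exact: abs_log_pow_ge0.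
  by rewrite w1 sqrtr1; under eq_integral do rewrite mul1r.
pose X v := abs_log_pow nu `|\sum_(j < k) tnth v j * tnth s j|%R.
pose Y v := abs_log_pow nu `|\sum_(j < k) tnth v j * tnth t j|%R.
apply: (@le_trans _ _ (\int[@gauss_tuple R k]_v
    ((2 `^ (nu - 1))%:E * (X v + 1) + Y v))).
  apply: ge0_le_integral => //.
  - by move=> v _; exact: abs_log_pow_ge0.
  - apply: (measurableT_comp (measurable_abs_log_pow nu1)).
    apply: (measurableT_comp
      (continuous_measurable_fun (@sqrt_continuous R))).
    apply: measurable_funD; apply: measurable_funX; apply: measurable_funM;
      by [|exact: mdot].
  - apply: emeasurable_funD; last exact: mlog.
    apply: emeasurable_funM => //; apply: emeasurable_funD => //; exact: mlog.
  - move=> v _; apply: (abs_log_pow_le nu1 a2 b0) => //.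
    by rewrite sqr_sqrtr// addr_ge0 ?sqr_ge0.
have X0 v : 0 <= X v by exact: abs_log_pow_ge0.
have mX1 : measurable_fun [set: k.-tuple R] (fun v => X v + 1).
  by apply: emeasurable_funD => //; exact: mlog.
rewrite ge0_integralD//; last 4 first.
- by move=> v _; rewrite mule_ge0 ?lee_fin ?powR_ge0// adde_ge0.
- exact: emeasurable_funM.
- by move=> v _; exact: abs_log_pow_ge0.
- exact: mlog.
rewrite [X in _ + X <= _]intJ// ge0_integralZl//; last first.
  by move=> v _; rewrite adde_ge0.
rewrite ge0_integralD//; last exact: mlog.
rewrite [X in _ * (X + _) + _]intJ// integral_cst// mul1e.
by rewrite [X in _ * (_ + X) + _](probability_setT (@gauss_tuple R k)).
Qed.

End log_moment.

(** * Reduction of the complex pairing to two real linear forms *)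

Lemma unit_direction (R : realType) k (v : k.+1.-tuple R) :
  exists w : k.+1.-tuple R,
  (\sum_(j < k.+1) tnth w j ^+ 2 = 1) /\
  forall j, (tnth v j = Num.sqrt (\sum_(j < k.+1) tnth v j ^+ 2) * tnth w j).
Proof.
set n2 := (\sum_(j < k.+1) tnth v j ^+ 2).
have n2_ge0 : (0 <= n2) by apply: sumr_ge0 => j _; exact: sqr_ge0.
(* For the zero vector any unit vector will do; the first basis vector exists because the dimension
   is [k.+1]. *)
have [n20|n2_neq0] := eqVneq n2 0.
  exists [tuple (j == ord0)%:R | j < k.+1]; split.
    rewrite big_ord_recl tnth_mktuple eqxx expr1n big1 ?addr0// => j _.
    by rewrite tnth_mktuple -val_eqE/= expr0n.
  move=> j; rewrite n20 sqrtr0 mul0r; apply/eqP; rewrite -sqrf_eq0.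
  have /eqP := n20; rewrite /n2 psumr_eq0; last by move=> i _; exact: sqr_ge0.
  by move=> /allP/(_ j); rewrite mem_index_enum => /(_ isT).
have n2_gt0 : (0 < n2) by rewrite lt_neqAle eq_sym n2_neq0.
exists [tuple (tnth v j / Num.sqrt n2) | j < k.+1]; split.
  under eq_bigr do rewrite tnth_mktuple expr_div_n sqr_sqrtr//.
  by rewrite -mulr_suml mulfV.
by move=> j; rewrite tnth_mktuple mulrC divfK// gt_eqF// sqrtr_gt0.
Qed.

(** The coordinates of [v] are real, so multiplication by them acts separately on real and imaginary
    parts. *)
Lemma normc_pairing_real (R : realType) k (v : k.-tuple R) (u : k.-tuple R[i]) :
  ComplexField.Normc.normc (pairing (real_tuple v) u) =
  Num.sqrt ((\sum_(j < k) tnth v j * complex.Re (tnth u j)) ^+ 2 +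
            (\sum_(j < k) tnth v j * complex.Im (tnth u j)) ^+ 2).
Proof.
suff -> : pairing (real_tuple v) u =
    Complex (\sum_(j < k) tnth v j * complex.Re (tnth u j))
            (\sum_(j < k) tnth v j * complex.Im (tnth u j)) by [].
rewrite /pairing; elim/big_rec3: _ => // j x y _ _ ->.
rewrite tnth_map; case: (tnth u j) => a b.
by apply/eqP; rewrite eq_complex/= !mul0r subr0 addr0 !eqxx.
Qed.

Theorem proposition4p2 (R : realType) (k : nat) (hk : (1 <= k)%N)
    (nu : R) (hnu : 1 <= nu) (u : k.-tuple R[i]) (hu : hnorm u = 1) :
  (\int[@gauss_tuple R k]_a
     abs_log_pow nu (ComplexField.Normc.normc (pairing (real_tuple a) u))
   <= Gamma_nu nu)%E.
Proof.
case: k hk u hu => [//|k] _ u hu.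
pose s := map_tuple (@complex.Re R) u.
pose t := map_tuple (@complex.Im R) u.
have [s' [s1 sE]] := unit_direction s.
have [t' [t1 tE]] := unit_direction t.
(* a and b are the Euclidean norms of Re u and Im u, whose unit directions are [s'] and [t']. *)
set a := Num.sqrt _ in sE; set b := Num.sqrt _ in tE.
have ab1 : a ^+ 2 + b ^+ 2 = 1.
  rewrite !sqr_sqrtr ?sumr_ge0// => [|j _|j _]; rewrite ?sqr_ge0//.
  rewrite -(expr1n _ 2) -hu sqr_sqrtr ?sumr_ge0//; last first.
    by move=> j _; exact: sqr_ge0.
  rewrite -big_split; apply: eq_bigr => j _; rewrite !tnth_map/=.
  by case: (tnth u j) => x y /=; rewrite sqr_sqrtr// addr_ge0 ?sqr_ge0.
have a0 : 0 <= a by exact: sqrtr_ge0.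
have b0 : 0 <= b by exact: sqrtr_ge0.
under eq_integral => v _.
  rewrite normc_pairing_real.
  rewrite (eq_bigr (fun j => a * (tnth v j * tnth s' j))); last first.
    by move=> j _; rewrite mulrCA -sE tnth_map.
  rewrite [X in _ + X ^+ 2](eq_bigr
    (fun j => b * (tnth v j * tnth t' j))); last first.
    by move=> j _; rewrite mulrCA -tE tnth_map.
  rewrite -!mulr_sumr; over.
(* As a^2 + b^2 = 1, one of a and b is at least 1/2; the integrand is symmetric in the two forms, so
   they can be exchanged. *)
have [a2|a2] := leP 2^-1 a; first exact: gauss_tuple_log_moment_le.
have b2 : 2^-1 <= b by nra.
under eq_integral do rewrite addrC.
by apply: gauss_tuple_log_moment_le => //; rewrite addrC.
Qed.
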